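(* Let $A\subset\mathbb{R}^2$ be a compact set that is regular (i.e. $A$ equals the closure of its interior) and whose interior has at most two connected components. If $g_A=g_K$ for some convex body $K\subset\mathbb{R}^2$, then $A$ is convex.
   Context: For a compact set $A\subset\mathbb{R}^n$, the covariogram $g_A:\mathbb{R}^n\to\mathbb{R}$ is defined by $g_A(x)=\lambda_n(A\cap(A+x))$, where $\lambda_n$ is $n$-dimensional Lebesgue measure and $A+x=\{a+x:a\in A\}$. A convex body in $\mathbb{R}^n$ is a compact convex set with non-empty interior. *)

(* Defs.v *)
From HB Require Import structures.
From mathcomp Require Import all_boot all_order all_algebra.
From mathcomp Require Import all_classical all_reals all_analysis.

Set Implicit Arguments.
Unset Strict Implicit.
Unset Printing Implicit Defensive.

Import Order.TTheory GRing.Theory Num.Theory.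
Import numFieldNormedType.Exports.

Local Open Scope classical_set_scope.
Local Open Scope ring_scope.

(* The regular module [R^o] (convertible to [R]) gives the product its
   [R]-module structure, which [convex_set] needs; the topology is the product
   topology. *)
Notation plane R := (R^o * R^o)%type.

Definition lebesgue2 (R : realType) : set (plane R) -> \bar R :=
  (@lebesgue_measure R \x @lebesgue_measure R)%E.

Definition translate (R : realType) (A : set (plane R)) (x : plane R) :
  set (plane R) := [set a + x | a in A].

(* [fine] loses nothing for compact [A]: the measure is then finite. *)
Definition covariogram (R : realType) (A : set (plane R)) (x : plane R) : R :=
  fine (lebesgue2 (A `&` translate A x)).

Definition convex_body (R : realType) (K : set (plane R)) : Prop :=
  [/\ compact K, @convex_set R (plane R) K & K° !=set0].

Definition regular (R : realType) (A : set (plane R)) : Prop :=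
  A = closure A°.

Definition components (R : realType) (U : set (plane R)) :
  set (set (plane R)) := [set connected_component U x | x in U].

(* Main.v *)
Require Import Defs.
From HB Require Import structures.
From mathcomp Require Import all_boot all_order all_algebra.
From mathcomp Require Import all_classical all_reals all_analysis.
From mathcomp Require Import measurable_realfun ring lra.
Import Order.TTheory GRing.Theory Num.Theory.
Import numFieldNormedType.Exports.
Local Open Scope classical_set_scope.
Local Open Scope ring_scope.

(* Fix a non-vertical direction u. The rate at which g_A decreases from 0 along u
   is the integral, over the lines parallel to u, of the number of intervals in
   which the line meets A. For the convex body K this is the length of the
   projection of K along u, which is at most the length of the convex hull of the
   projection of A, because the support of g_K is K - K and that of g_A lies in
   A - A. So if the projection of int A is an interval, no set of positive
   measure of lines meets A in two intervals, and A contains every segment of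
   direction u with endpoints in int A.
   If x and y lie in different components of int A and u is the direction of
   y - x, then the projections along u of the two components are intervals with
   a common point, so that the projection of int A is an interval; the segment
   from x to y then lies in int A, a contradiction. Hence int A is connected, its
   projections are all intervals, and A is convex. *)

Local Notation mu := lebesgue_measure.

(** * Lebesgue measure on the line: the points of a set that a shift takes out of it *)

Lemma lebesgue_measure_translate (R : realType) (c : R) (B : set R) :
  measurable B -> mu [set x | B (x + c)] = mu B.
Proof.
move=> mB.
have mc : measurable_fun setT (fun x : measurableTypeR R =>
  x + c : measurableTypeR R).
  exact: measurable_funD.
pose f : {mfun measurableTypeR R >-> measurableTypeR R} := HB.pack (fun x :
  measurableTypeR R => x + c : measurableTypeR R) (isMeasurableFun.Build _ _ _ _
  _ mc).
transitivity (pushforward mu f B) => //.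
apply/esym/lebesgue_measure_unique => //= _ [[a b]] _ <-.
rewrite /pushforward.
have -> : (fun x => x + c) @^-1` `]a, b] = `]a - c, b - c]%classic.
  by apply/seteqP; split => x /=; rewrite !in_itv/= ltrBlDr lerBrDr.
rewrite !lebesgue_measure_itv/= !lte_fin ltrD2r.
by case: ifP => // _; congr EFin; lra.
Qed.

Lemma measurable_translate (R : realType) (c : R) (B : set R) :
  measurable B -> measurable [set x | B (x + c)].
Proof.
move=> mB; rewrite -[X in measurable X]setTI.
have : measurable_fun setT (fun x : R => x + c) by exact: measurable_funD.
exact.
Qed.

Lemma lebesgue_measure_segment (R : realType) (b c : bool) (a t : R) :
  0 < t -> mu [set` Interval (BSide b a) (BSide c (a + t))] = t%:E.
Proof.
by move=> t0; rewrite lebesgue_measure_itv/= lte_fin ltrDl t0 -EFinB addrAC subrr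
  add0r.
Qed.

(* Both [B] and its translate are measured on [[d + t, c + t[]; the difference
   is the measure of [B] on [[c, c + t[] minus that on [[d, d + t[]. *)
Lemma exit_measure (R : realType) (B : set R) (c d t : R) :
  measurable B -> 0 < t -> d < c ->
  (forall x, c <= x < c + t -> B x) -> (forall x, d <= x < d + t -> ~ B x) ->
  (t%:E <= lebesgue_measure
    ([set x | B x /\ ~ B (x - t)%R] `&` `[(d + t)%R, (c + t)%R[))%E.
Proof.
move=> mB t0 dc cB dB.
have mBt : measurable [set x | B (x - t)%R] by exact: measurable_translate.
(* Otherwise [c] would lie in both intervals, inside [B] and outside it. *)
have dtc : d + t <= c.
  by rewrite leNgt; apply/negP => h; apply: (dB c);
    [rewrite h (ltW dc)|apply: cB; rewrite lexx; lra].
have fin (X : set R) (a b : R) : measurable X -> mu (X `&` `[a, b[) \is a fin_num.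
  move=> mX; rewrite ge0_fin_numE//; apply: (@le_lt_trans _ _ (mu `[a, b[)).
    by apply: le_measure; rewrite ?inE//; exact: measurableI.
  by rewrite lebesgue_measure_itv/=; case: ifP => _; rewrite ?ltry// -EFinB ltry.
have E1 : mu (B `&` `[d, (c + t)%R[) = (mu (B `&` `[(d + t)%R, (c + t)%R[))%E.
  congr (mu _); apply/seteqP; split => x /= [Bx];
    rewrite in_itv/= => /andP[h1 h2]; split => //; rewrite in_itv/= h2 andbT.
    by rewrite leNgt; apply/negP => h; apply: (dB x) => //; rewrite h1 h.
  lra.
have E2 : mu (B `&` `[d, (c + t)%R[) = (mu (B `&` `[d, c[) + t%:E)%E.
  have -> : B `&` `[d, c + t[ = (B `&` `[d, c[) `|` `[c, c + t[.
    apply/seteqP; split => x /=; rewrite !in_itv/=.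
      by move=> [Bx /andP[h1 h2]]; case: (ltP x c) => h; [left; rewrite h1|right;
        rewrite ?h2].
    move=> [[Bx /andP[h1 h2]]|/andP[h1 h2]].
      by split=> //; apply/andP; split; lra.
    by split; [apply: cB; rewrite h1|apply/andP; split; lra].
  rewrite measureU//; first last.
  - by apply/seteqP; split => x //= [[_]];
    rewrite !in_itv/= => /andP[_ h1] /andP[h2 _]; lra.
  - exact: measurableI.
  by congr (_ + _)%E; exact: lebesgue_measure_segment.
have E3 : mu ([set x | B (x - t)%R] `&` `[d + t, c + t[) = mu (B `&` `[d, c[).
  rewrite -(@lebesgue_measure_translate _ (- t) (B `&` `[d, c[));
    last exact: measurableI.
  congr (mu _); apply/seteqP; split => x /= [Bx];
    rewrite !in_itv/= => /andP[h1 h2]; split => //; apply/andP; split; lra.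
set I := `[(d + t)%R, (c + t)%R[%classic in E1 E3 *.
have mI : measurable I by exact: measurable_itv.
have le1 : (mu (B `&` I) <= mu ([set x | B x /\ ~ B (x - t)%R] `&` I)
    + mu ([set x | B (x - t)%R] `&` I))%E.
  have mD : measurable [set x | B x /\ ~ B (x - t)%R].
    by have := measurableD mB mBt.
  apply: (le_trans _ (measureU2 _ _ _)); [|exact: measurableI|exact: measurableI].
  apply: le_measure; rewrite ?inE//; [exact: measurableI|by apply: measurableU;
    exact: measurableI|].
  by move=> x /= [Bx h]; have [?|?] := pselect (B (x - t)); [right|left].
move: le1; rewrite E3 -E1 E2 addeC leeD2rE//; exact: fin.
Qed.

(** If [x - t] exceeds [inf B], some point of [B] lies below it, and the interval [B], which also
    contains [x], contains [x - t]. So the set lies within [t] of [inf B]. *)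
Lemma exit_measure_convex (R : realType) (B : set R) (t : R) :
  0 < t -> (exists m, lbound B m) -> is_interval B -> measurable B ->
  (mu [set x | B x /\ ~ B (x - t)%R] <= t%:E)%E.
Proof.
move=> t0 [m lbm] iB mB.
have [->|/set0P B0] := eqVneq B set0.
  rewrite (_ : [set x | _] = set0) ?measure0 ?lee_fin ?ltW//.
  by apply/seteqP; split => // x [].
have hB : has_inf B by split => //; exists m.
have mBt : measurable [set x | B (x - t)%R] by exact: measurable_translate.
apply: (@le_trans _ _ (mu `[inf B, inf B + t])).
  apply: le_measure; rewrite ?inE//; first by have := measurableD mB mBt.
  move=> x /= [Bx Bxt]; rewrite in_itv/= (ge_inf hB.2)//= leNgt; apply/negP => h.
  have xt : 0 < x - t - inf B by lra.
  have [y By yx] := inf_adherent xt hB.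
  by apply: Bxt; apply: (iB y x) => //; apply/andP; split; lra.
by rewrite lebesgue_measure_segment.
Qed.

(** * Borel sets of the plane *)

(* [plane R] carries the topology, [mplane R] (convertible to it) the product
   sigma-algebra. *)
Notation mplane R := (measurableTypeR R * measurableTypeR R)%type.

(** The boxes with rational centre and radius [1 / (n + 1)] that fit in [U] are countably many and
    cover it. *)
Lemma open_measurable_plane (R : realType) (U : set (plane R)) :
  open U -> measurable (U : set (mplane R)).
Proof.
move=> oU.
pose box (i : rat * rat * nat) : set (mplane R) :=
  ball (ratr i.1.1 : R) (i.2.+1%:R^-1) `*` ball (ratr i.1.2 : R) (i.2.+1%:R^-1).
pose F i : set (mplane R) := if `[< box i `<=` U >] then box i else set0.
rewrite (_ : U = \bigcup_i F i).
  apply: countable_bigcupT_measurable => [|i]; first exact: countableP.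
  rewrite /F; case: ifPn => // _.
  by apply: measurableX; apply: open_measurable; exact: ball_open.
apply/seteqP; split => [[x y] Uxy|z [i _]]; last first.
  by rewrite /F; case: ifPn => // /asboolP; exact.
have /nbhs_ballP[e /= e0 eU] : nbhs ((x, y) : plane R) U by exact: open_nbhs_nbhs.
(* Half of [e], since [(x, y)] and any point of the box are each within the radius of the centre. *)
have [n ne] : exists n : nat, n.+1%:R^-1 < e / 2.
  have e2 : 0 < e / 2 by lra.
  by have [n _ /(_ n (leqnn _))] := near_infty_natSinv_lt (PosNum e2); exists n.
have n0 : 0 < n.+1%:R^-1 :> R by rewrite invr_gt0.
have rat_near (a : R) : exists q : rat, `|ratr q - a| < n.+1%:R^-1.
  move: n0; set h := n.+1%:R^-1 => h0; have /rat_in_itvoo[q] : a - h < a + h by lra.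
  rewrite in_itv/= => /andP[q1 q2]; by exists q; rewrite ltr_norml; apply/andP;
    split; lra.
have [[q qx] [p py]] := (rat_near x, rat_near y).
exists (q, p, n) => //; rewrite /F; case: asboolP => [_|]; first by split;
  rewrite /ball/=.
case=> -[a b] [/=]; rewrite /ball/= => ha hb.
have near2 (c u v : R) : `|c - u| < n.+1%:R^-1 -> `|c - v| < n.+1%:R^-1 -> `|u -
  v| < e.
  move: ne; set h := n.+1%:R^-1 => ne hu hv.
  rewrite (_ : u - v = (c - v) - (c - u)); last by ring.
  by apply: (le_lt_trans (ler_normB _ _)); lra.
by apply: eU; split; [exact: near2 qx ha|exact: near2 py hb].
Qed.

Lemma compact_closed_plane (R : realType) (A : set (plane R)) :
  compact A -> closed A.
Proof. by apply: compact_closed; exact: norm_hausdorff. Qed.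

Lemma compact_measurable_plane (R : realType) (A : set (plane R)) :
  compact A -> measurable (A : set (mplane R)).
Proof.
move=> /compact_closed_plane cA; rewrite -[A]setCK.
by apply: measurableC; apply: open_measurable_plane; exact: closed_openC.
Qed.

(** * Sections by lines of slope [m], and Fubini's theorem *)

(* The parameter of the line is the abscissa [r]; its label [s] is its
   intercept with the second axis. *)
Definition line_section (R : realType) (m : R) (A : set (plane R)) (s : R) :
  set R :=
  [set r | A (r, s + m * r)].

Lemma measurable_shear (R : realType) (m : R) (A : set (mplane R)) :
  measurable A -> measurable ([set z | A (z.1, z.2 + m * z.1)] : set (mplane R)).
Proof.
move=> mA; rewrite -[X in measurable X]setTI.
have : measurable_fun setT (fun z : mplane R => (z.1, z.2 + m * z.1) : mplane R).
  apply: measurable_fun_pair => //=; apply: measurable_funD => //=.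
  exact: measurable_funM.
exact.
Qed.

Lemma line_sectionE (R : realType) (m : R) (A : set (plane R)) (s : R) :
  line_section R m A s = ysection ([set z | A (z.1, z.2 + m * z.1)] :
    set (mplane R)) s.
Proof. by apply/seteqP; split => r; rewrite /ysection /= inE. Qed.

Lemma measurable_line_section (R : realType) (m : R) (A : set (plane R)) (s : R) :
  measurable (A : set (mplane R)) -> measurable (line_section R m A s).
Proof.
move=> mA; rewrite line_sectionE; apply: measurable_ysection.
exact: measurable_shear.
Qed.

Lemma measurable_fun_line_section (R : realType) (m : R) (A : set (plane R)) :
  measurable (A : set (mplane R)) ->
  measurable_fun setT (fun s => mu (line_section R m A s)).
Proof.
move=> mA; under eq_fun do rewrite line_sectionE.
by apply: measurable_fun_ysection; exact: measurable_shear.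
Qed.

(** The shear [(r, s) -> (r, s + m r)] translates each vertical section, hence preserves the
    measure; exchanging the order of integration then slices by the lines of slope [m]. *)
Lemma lebesgue2_line_section (R : realType) (m : R) (A : set (plane R)) :
  measurable (A : set (mplane R)) ->
  lebesgue2 A = (\int[mu]_s mu (line_section R m A s))%E.
Proof.
move=> mA; have mS := measurable_shear R m A mA.
transitivity ((mu \x mu)%E ([set z | A (z.1, z.2 + m * z.1)] : set (mplane R))).
  rewrite /lebesgue2 /product_measure1; apply: eq_integral => r _ /=.
  have -> : xsection ([set z | A (z.1, z.2 + m * z.1)] : set (mplane R)) r =
      [set s | xsection (A : set (mplane R)) r (s + m * r)].
    by apply/seteqP; split => s; rewrite /xsection /= !inE.
  by rewrite lebesgue_measure_translate//; exact: measurable_xsection.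
rewrite (@product_measure_unique _ _ _ _ R mu mu (product_measure2 mu mu))//;
  last first.
  by move=> B C mB mC; exact: product_measure2E.
by rewrite /product_measure2; apply: eq_integral => s _ /=; rewrite line_sectionE.
Qed.

(** * Compact sets, translates and covariograms *)

Lemma compact_box (R : realType) (A : set (plane R)) : compact A ->
  exists M : R, forall z, A z -> `|z.1| <= M /\ `|z.2| <= M.
Proof.
move=> /compact_bounded[M [_ hM]]; exists (M + 1) => z Az.
have := hM (M + 1) _ z Az; rewrite ltrDl => /(_ ltr01).
by rewrite /= [`|z|]/(Num.max `|z.1| `|z.2|) ge_max => /andP[].
Qed.

Lemma lebesgue2_compact_fin_num (R : realType) (A : set (plane R)) :
  compact A -> lebesgue2 A \is a fin_num.
Proof.
move=> cA; have [M hM] := compact_box _ _ cA.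
rewrite ge0_fin_numE; last exact: (measure_ge0 (mu \x mu)%E).
apply: (@le_lt_trans _ _ ((mu \x mu)%E (`[- M, M] `*` `[- M, M] : set (mplane R)))).
  apply: le_measure; rewrite ?inE.
  - exact: compact_measurable_plane.
  - by apply: measurableX; exact: measurable_itv.
  - by move=> z /hM[h1 h2]; split; rewrite /= in_itv/= -ler_norml.
rewrite product_measure1E; [|exact: measurable_itv|exact: measurable_itv].
have fin : mu `[- M, M] \is a fin_num.
  by rewrite lebesgue_measure_itv/=; case: ifP.
by rewrite -ge0_fin_numE ?fin_numM// mule_ge0.
Qed.

Lemma translateE (R : realType) (A : set (plane R)) (x z : plane R) :
  translate A x z <-> A (z - x).
Proof.
split=> [[a Aa <-]|Az]; first by rewrite addrK.
by exists (z - x) => //; rewrite subrK.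
Qed.

Lemma measurable_translate_plane (R : realType) (A : set (plane R)) (x : plane R) :
  measurable (A : set (mplane R)) -> measurable (translate A x : set (mplane R)).
Proof.
move=> mA.
have -> : translate A x = [set z | A (z.1 - x.1, z.2 - x.2)].
  by apply/seteqP; split => -[a b] /=; rewrite translateE.
rewrite -[X in measurable X]setTI.
have : measurable_fun setT (fun z : mplane R => (z.1 - x.1, z.2 - x.2) : mplane R).
  by apply: measurable_fun_pair => //=; exact: measurable_funB.
exact.
Qed.

Lemma covariogram0 (R : realType) (A : set (plane R)) :
  covariogram A 0 = fine (lebesgue2 A).
Proof.
congr (fine (lebesgue2 _)); apply/seteqP; split => z; first by case.
by move=> Az; split => //; rewrite translateE subr0.
Qed.

(** * The loss along a direction *)

(* [-d/dt] at [0] of the covariogram along the direction [(1, m)] is the integral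
   over [s] of the limit of [loss t s / t], the number of intervals composing
   the section of [A] by the line labelled [s]. *)
Definition loss (R : realType) (m : R) (A : set (plane R)) (t s : R) : \bar R :=
  mu [set r | line_section R m A s r /\ ~ line_section R m A s (r - t)].

(** Subtracting [(t, m t)] from a point keeps it on its line of slope [m] and lowers its abscissa by
    [t]. *)
Lemma lossE (R : realType) (m : R) (A : set (plane R)) (t s : R) :
  loss R m A t s = mu (line_section R m (A `\` translate A (t, m * t)) s).
Proof.
congr (mu _); apply/seteqP; split => r [Ar nAr]; split => //; apply: contra_not nAr;
  rewrite translateE /line_section/=.
- by rewrite (_ : _ - _ = (r - t, s + m * (r - t)))//; congr pair; rewrite /=; ring.
- by rewrite (_ : _ - _ = (r - t, s + m * (r - t)))//; congr pair; rewrite /=; ring.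
Qed.

Lemma measurable_loss (R : realType) (m : R) (A : set (plane R)) (t : R) :
  compact A -> measurable_fun setT (loss R m A t).
Proof.
move=> /compact_measurable_plane mA; rewrite (funext (lossE R m A t)).
by apply: measurable_fun_line_section; apply: measurableD => //;
  exact: measurable_translate_plane.
Qed.

(** By Fubini the integral is the measure of the part of [A] outside its translate by [(t, m t)],
    and [covariogram A 0] is the full measure of [A]. *)
Lemma integral_loss (R : realType) (m : R) (A : set (plane R)) (t : R) :
  compact A ->
  (\int[mu]_s loss R m A t s)%E =
    (covariogram A 0 - covariogram A (t, m * t)%R)%:E.
Proof.
move=> cA; have mA := compact_measurable_plane _ _ cA.
have mT := measurable_translate_plane R A (t, m * t) mA.
under eq_integral do rewrite lossE.
rewrite -lebesgue2_line_section; last exact: measurableD.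
have fA := lebesgue2_compact_fin_num _ _ cA.
have E : lebesgue2 A = (lebesgue2 (A `\` translate A (t,
  m * t)%R) + lebesgue2 (A `&` translate A (t, m * t)%R))%E.
  exact: (measureDI (mu \x mu)%E mA mT).
rewrite covariogram0 /covariogram.
move: (fA); rewrite E fin_numD => /andP[f1 f2].
by rewrite fineD// addrK fineK.
Qed.

(** * Convex bodies: support of the covariogram and upper bound for the loss *)

Definition plane_conv (R : realType) (p : R) (x y : plane R) : plane R :=
  (p * x.1 + (1 - p) * y.1, p * x.2 + (1 - p) * y.2).

Lemma convex_setP (R : realType) (K : set (plane R)) :
  @convex_set R (plane R) K <->
  forall x y p, K x -> K y -> 0 <= p -> p <= 1 ->
    K (plane_conv R p x y).
Proof.
split=> [cK x y p Kx Ky p0 p1|cK x y l].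
  by have := cK x y (Itv01 p0 p1); rewrite !inE => /(_ Kx Ky).
by rewrite !inE => Kx Ky; apply: (cK x y l%:num Kx Ky).
Qed.

(* The copy [(1 - e) k2 + e K] of [K] lies in [K] and in its translate. *)
Lemma covariogram_convex_gt0 (R : realType) (K : set (plane R)) (k1 k2 : plane R)
    (e : R) :
  convex_body K -> K k1 -> K k2 -> 0 < e < 1 ->
  0 < covariogram K ((1 - e) * (k2.1 - k1.1), (1 - e) * (k2.2 - k1.2)).
Proof.
move=> [cK /convex_setP xK [c Kc]] K1 K2 /andP[e0 e1].
set x : plane R := (_, _).
have /nbhs_ballP[d /= d0 dK] := Kc.
(* [Q] is the image of the ball of radius [d] about [c] under the homothety
   [v -> (1 - e) k2 + e v]. *)
pose q1 := (1 - e) * k2.1 + e * c.1; pose q2 := (1 - e) * k2.2 + e * c.2.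
pose Q : set (mplane R) := ball (q1 : R) (e * d) `*` ball (q2 : R) (e * d).
have ed : 0 < e * d by exact: mulr_gt0.
have mK := compact_measurable_plane _ _ cK.
have QK : Q `<=` K `&` translate K x.
  move=> [z1 z2] [/=]; rewrite /ball/= => hz1 hz2.
  (* The preimage of [z] under this homothety: [z = (1 - e) k2 + e w] and
     [z - x = (1 - e) k1 + e w]. *)
  pose w : plane R := ((z1 - (1 - e) * k2.1) / e, (z2 - (1 - e) * k2.2) / e).
  have scale (a b z : R) : `|(1 - e) * a +
    e * b - z| < e * d -> `|b - (z - (1 - e) * a) / e| < d.
    have -> : (1 - e) * a + e * b - z = e * (b - (z - (1 - e) * a) / e).
      by field; rewrite gt_eqF.
    by rewrite normrM (gtr0_norm e0) ltr_pM2l.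
  have Kw : K w by apply: dK; split; rewrite /ball/=; exact: scale.
  have comb k : K k -> K ((1 - e) * k.1 + (1 - (1 - e)) * w.1,
    (1 - e) * k.2 + (1 - (1 - e)) * w.2).
    by move=> Kk; apply: xK => //; lra.
  have e_neq0 : e != 0 by rewrite gt_eqF.
  split.
    rewrite (_ : (z1, z2) = ((1 - e) * k2.1 + (1 - (1 - e)) * w.1,
      (1 - e) * k2.2 + (1 - (1 - e)) * w.2)); first exact: comb.
    by congr pair; rewrite /w/=; field.
  rewrite translateE (_ : (z1, z2) - x = ((1 - e) * k1.1 + (1 - (1 - e)) * w.1,
    (1 - e) * k1.2 + (1 - (1 - e)) * w.2)); first exact: comb.
  by congr pair; rewrite /w/=; field.
have mball (a : R) : measurable (ball a (e * d)).
  by apply: open_measurable; exact: ball_open.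
have mI : measurable (K `&` translate K x : set (mplane R)).
  by apply: measurableI => //; exact: measurable_translate_plane.
rewrite /covariogram fine_gt0//; apply/andP; split.
  apply: (@lt_le_trans _ _ ((mu \x mu)%E Q)).
    have -> : (mu \x mu)%E Q = (mu (ball (q1 : R) (e * d)) * mu (ball (q2 :
      R) (e * d)))%E.
      by apply: product_measure1E; exact: mball.
    rewrite !lebesgue_measure_ball ?ltW//.
    by rewrite -EFinM lte_fin mulr_gt0// mulrn_wgt0.
  by apply: le_measure; rewrite ?inE//; by apply: measurableX; exact: mball.
apply: (@le_lt_trans _ _ (lebesgue2 K)).
  by apply: le_measure; rewrite ?inE//; exact: subIsetl.
by rewrite ltey_eq lebesgue2_compact_fin_num.
Qed.

Lemma covariogram_gt0 (R : realType) (A : set (plane R)) (x : plane R) :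
  0 < covariogram A x -> exists2 a, A a & A (a - x).
Proof.
move=> gx; suff [a [Aa]] : (A `&` translate A x) !=set0.
  by rewrite translateE; exists a.
apply/set0P/eqP => A0; move: gx; rewrite /covariogram A0.
by rewrite /lebesgue2 (@measure0 _ _ _ (mu \x mu)%E)/= ltxx.
Qed.

Definition intercept (R : realType) (m : R) (z : plane R) : R := z.2 - m * z.1.

(** This bounds the diameter of the projection of [A] along [(1, m)], read on the second axis. *)
Definition intercepts_within (R : realType) (m : R) (A : set (plane R)) (L : R) :=
  forall x y, A x -> A y -> intercept R m y - intercept R m x <= L.

(** The covariogram is positive at [(1 - e) (k2 - k1)], so this vector is a difference of two points
    of [A], and [(1 - e) D <= L] for every small [e]. *)
Lemma covariogram_intercepts_within (R : realType) (m : R) (A K : set (plane R))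
    (L : R) :
  convex_body K -> covariogram A = covariogram K ->
  intercepts_within R m A L -> intercepts_within R m K L.
Proof.
move=> bK gAK AL k1 k2 K1 K2.
set D := _ - _; rewrite leNgt; apply/negP => LD.
have shrink (e : R) : 0 < e < 1 -> 0 <= L /\ (1 - e) * D <= L.
  move=> e01; have := covariogram_convex_gt0 _ _ _ _ _ bK K1 K2 e01.
  rewrite -gAK => /covariogram_gt0[a Aa Aax].
  split; first by have := AL _ _ Aa Aa; rewrite subrr.
  apply: le_trans (AL _ _ Aax Aa); rewrite le_eqVlt; apply/orP; left; apply/eqP.
  by rewrite /D /intercept/=; ring.
have [L0 _] : 0 <= L /\ (1 - 1 / 2) * D <= L by apply: shrink; apply/andP; split;
  lra.
have D0 : 0 < D by exact: le_lt_trans LD.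
(* This [e] gives [(1 - e) D = (D + L) / 2], which exceeds [L]. *)
have De : ((D - L) / (2 * D)) * (2 * D) = D - L by rewrite divfK// gt_eqF//; lra.
have e01 : 0 < (D - L) / (2 * D) < 1.
  apply/andP; split; first by apply: divr_gt0; lra.
  by rewrite ltr_pdivrMr; lra.
have [_] := shrink _ e01.
by move: De; set e := (D - L) / (2 * D) => De; lra.
Qed.

(** A line meets [K] in an interval, so it loses at most [t]; the labels of the lines that meet [K]
    fill at most a segment of length [L]. *)
Lemma integral_loss_convex (R : realType) (m : R) (K : set (plane R)) (L t : R) :
  convex_body K -> intercepts_within R m K L -> 0 < t ->
  (\int[mu]_s loss R m K t s <= (t * L)%:E)%E.
Proof.
move=> [cK /convex_setP xK [c /interior_subset Kc]] KL t0.
have [M hM] := compact_box _ _ cK.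
pose S := [set intercept R m z | z in K].
have hS : has_inf S.
  split; first by exists (intercept R m c), c.
  exists (intercept R m c - L) => _ [z Kz <-]; have := KL z c Kz Kc; lra.
have L0 : 0 <= L by have := KL c c Kc Kc; rewrite subrr.
have Sin z : K z -> inf S <= intercept R m z <= inf S + L.
  move=> Kz; apply/andP; split; first by apply: ge_inf hS.2 _ _; exists z.
  rewrite -lerBlDr; apply: lb_le_inf hS.1 _ => _ [w Kw <-].
  by have := KL w z Kw Kz; lra.
apply: (@le_trans _ _ (\int[mu]_s (t%:E * (\1_(`[inf S, inf S + L]) s)%:E))%E).
  apply: ge0_le_integral => //.
  - exact: measurable_loss.
  - by apply: measurable_funeM; apply/measurable_EFinP; exact: measurable_indic.
  move=> s _; have [sI|sI] := pselect (`[inf S, inf S + L]%classic s).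
    rewrite indicE mem_set// mule1; apply: exit_measure_convex => //.
    - by exists (- M) => r /hM/= [+ _]; rewrite ler_norml => /andP[].
    - move=> x y Kx Ky z /andP[xz zy].
      have [xy|yx] := ltP x y; last first.
        by have <- : x = z; [lra|].
      have := xK _ _ ((y - z) / (y - x)) Kx Ky.
      rewrite ler_pdivrMr ?ler_pdivlMr ?subr_gt0// => /= H.
      rewrite /line_section/= (_ : (z,
        _) = ((y - z) / (y - x) * x + (1 - (y - z) / (y - x)) * y,
        (y - z) / (y - x) * (s + m * x) + (1 - (y - z) / (y - x)) * (s + m * y))).
        by apply: H; lra.
      by congr pair; field; rewrite subr_eq0 gt_eqF.
    - by apply: measurable_line_section; exact: compact_measurable_plane.
  rewrite indicE memNset// mule0 /loss (_ : [set r | _] = set0) ?measure0//.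
  apply/seteqP; split => // r [Kr _]; apply: sI; rewrite /= in_itv/=.
  by have := Sin _ Kr; rewrite /intercept/= addrK.
rewrite ge0_integralZl//; last 2 first.
- by apply/measurable_EFinP; exact: measurable_indic.
- by rewrite lee_fin ltW.
rewrite integral_indic// setIT EFinM; apply: lee_wpmul2l;
  first by rewrite lee_fin ltW.
have : (mu `[inf S, (inf S + L)%R] <= L%:E)%E.
  rewrite lebesgue_measure_itv/=; case: ifP => _; last by rewrite lee_fin.
  by rewrite -EFinB addrAC subrr add0r.
exact.
Qed.

(** * Lower bounds for the loss *)

Lemma line_nbhs (R : realType) (m : R) (U : set (plane R)) (s0 r0 : R) :
  open U -> U (r0, s0 + m * r0) ->
  exists2 e : R, 0 < e & forall s r, `|s0 - s| < e -> `|r0 - r| < e -> U (r,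
    s + m * r).
Proof.
move=> oU Uz.
have /nbhs_ballP[d /= d0 dU] : nbhs ((r0, s0 + m * r0) : plane R) U by exact:
  open_nbhs_nbhs.
(* Changes below [e] in label and abscissa change the ordinate by less than [e (1 + |m|) = d]. *)
pose e := d / (1 + `|m|).
have m1 : 0 < 1 + `|m| by rewrite ltr_pwDl.
have e0 : 0 < e by exact: divr_gt0.
have ed : e * (1 + `|m|) = d by rewrite divfK// gt_eqF.
exists e => // s r hs hr; apply: dU; split; rewrite /ball/=.
  by apply: lt_le_trans hr _; rewrite -ed;
    have := mulr_ge0 (ltW e0) (normr_ge0 m); lra.
rewrite (_ : _ - _ = (s0 - s) + m * (r0 - r)); last by ring.
apply: le_lt_trans (ler_normD _ _) _; rewrite normrM -ed mulrDr mulr1.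
by apply: ltr_leD => //; rewrite mulrC ler_wpM2r// ltW.
Qed.

Lemma limn_einf_ge (R : realType) (u : (\bar R)^nat) (c : \bar R) (N : nat) :
  (forall n, (N <= n)%N -> (c <= u n)%E) -> (c <= limn_einf u)%E.
Proof.
move=> cu; rewrite limn_einf_lim; apply: lime_ge; first exact: is_cvg_einfs.
by exists N => // n /= Nn; apply: le_ereal_inf_tmp => _ [k /= nk <-]; apply: cu;
  exact: leq_trans nk.
Qed.

Lemma limn_einf_le (R : realType) (u : (\bar R)^nat) (c : \bar R) :
  (forall n, (u n <= c)%E) -> (limn_einf u <= c)%E.
Proof.
move=> uc; rewrite limn_einf_lim; apply: lime_le; first exact: is_cvg_einfs.
by apply: nearW => n; apply: le_trans (uc n); apply: ereal_inf_lbound;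
  exists n => /=.
Qed.

Lemma loss_ge (R : realType) (m : R) (A : set (plane R)) (s c e : R) :
  compact A -> (forall r, `|c - r| < e -> A (r, s + m * r)) ->
  forall t, 0 < t < e -> (t%:E <= loss R m A t s)%E.
Proof.
move=> cA cB t /andP[t0 te]; have [M hM] := compact_box _ _ cA.
have mB := measurable_line_section R m A s (compact_measurable_plane _ _ cA).
have mBt : measurable [set r | line_section R m A s (r - t)] by exact:
  measurable_translate.
have mE : measurable [set r | line_section R m A s r /\ ~ line_section R m A s (r
  - t)].
  exact: (measurableD mB mBt).
(* [[d, d + t[] is placed to the left of the whole section, hence outside [A]. *)
pose d := Num.min c (- M) - 1 - t.
have [dc dM] : d < c /\ d + t < - M.
  by rewrite /d; case: (ltP c (- M)) => h; split; lra.
apply: le_trans (exit_measure _ _ c d t mB t0 dc _ _) _.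
- by move=> r /andP[r1 r2]; apply: cB; rewrite ltr_norml; apply/andP; split; lra.
- move=> r /andP[_ rd] /hM/= [+ _]; rewrite ler_norml => /andP[+ _]; lra.
apply: le_measure; rewrite ?inE//; exact: measurableI.
Qed.

(** The piece around [c1], preceded by the exterior of the bounding box, and the piece around [c2],
    preceded by the gap at [z], each lose at least [t], in disjoint windows. *)
Lemma loss_ge2 (R : realType) (m : R) (A : set (plane R)) (s c1 z c2 e : R) :
  compact A -> c1 < z < c2 -> e <= z - c1 ->
  (forall r, `|c1 - r| < e -> A (r, s + m * r)) ->
  (forall r, `|c2 - r| < e -> A (r, s + m * r)) ->
  (forall r, `|z - r| < e -> ~ A (r, s + m * r)) ->
  forall t, 0 < t < e -> ((2 * t)%:E <= loss R m A t s)%E.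
Proof.
move=> cA /andP[c1z zc2] ez cB1 cB2 zB t /andP[t0 te];
  have [M hM] := compact_box _ _ cA.
have mB := measurable_line_section R m A s (compact_measurable_plane _ _ cA).
have mBt : measurable [set r | line_section R m A s (r - t)] by exact:
  measurable_translate.
have mE : measurable [set r | line_section R m A s r /\ ~ line_section R m A s (r
  - t)].
  exact: (measurableD mB mBt).
pose d := Num.min c1 (- M) - 1 - t.
have [dc dM] : d < c1 /\ d + t < - M.
  by rewrite /d; case: (ltP c1 (- M)) => h; split; lra.
have E1 := exit_measure _ _ c1 d t mB t0 dc.
have E2 := exit_measure _ _ c2 z t mB t0 zc2.
set E := [set r | _] in E1 E2 mE.
apply: (@le_trans _ _ (mu (E `&` `[(d + t)%R,
  (c1 + t)%R[) + mu (E `&` `[(z + t)%R, (c2 + t)%R[))%E).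
  rewrite mulr_natl mulr2n EFinD; apply: leeD.
    apply: E1 => [r /andP[r1 r2]|r /andP[_ rd] /hM/= [+ _]].
      by apply: cB1; rewrite ltr_norml; apply/andP; split; lra.
    by rewrite ler_norml => /andP[+ _]; lra.
  apply: E2 => r /andP[r1 r2].
    by apply: cB2; rewrite ltr_norml; apply/andP; split; lra.
  by apply: zB; rewrite ltr_norml; apply/andP; split; lra.
have mI a b : measurable (E `&` `[a, b[) by apply: measurableI.
have <- : mu ((E `&` `[d + t, c1 + t[) `|` (E `&` `[z + t, c2 + t[)) =
    (mu (E `&` `[(d + t)%R, (c1 + t)%R[) + mu (E `&` `[(z + t)%R, (c2 + t)%R[))%E.
  apply: measureU; [exact: mI|exact: mI|].
  by apply/seteqP; split => // r [[_ /=]] + [_];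
    rewrite !in_itv/= => /andP[_ h1] /andP[h2 _]; lra.
apply: le_measure; rewrite ?inE//; first by apply: measurableU; exact: mI.
by move=> r [[]|[]].
Qed.

(** A gap at [z] persists on all lines with labels near [s0]. These lose at least [2 t], while every
    line that meets [U] loses at least [t], for [t] small depending on the line; dividing by [t] and
    applying Fatou's lemma leaves the width of [U] short of [C] by the excess. *)
Lemma intercepts_gap (R : realType) (m : R) (A U : set (plane R)) (s0 c1 z c2 C :
  R) :
  compact A -> open U -> U `<=` A ->
  is_interval [set s | exists r, U (r, s + m * r)] ->
  c1 < z < c2 -> U (c1, s0 + m * c1) -> U (c2, s0 + m * c2) -> ~ A (z,
    s0 + m * z) ->
  (forall t, 0 < t -> (\int[mu]_s loss R m A t s <= (t * C)%:E)%E) ->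
  exists2 d : R, 0 < d & intercepts_within R m U (C - d).
Proof.
move=> cA oU UA iP c1z2 U1 U2 nAz lossC.
have [e1 e10 B1] := line_nbhs _ _ _ _ _ oU U1.
have [e2 e20 B2] := line_nbhs _ _ _ _ _ oU U2.
have [e3 e30 B3] := line_nbhs _ _ _ _ _ (closed_openC (compact_closed_plane _ _
  cA)) nAz.
have [e e0 [ee1 ee2 ee3 ez]] : exists2 e :
  R, 0 < e & [/\ e <= e1, e <= e2, e <= e3 & e <= z - c1].
  exists (Num.min (Num.min e1 e2) (Num.min e3 (z - c1))).
    by rewrite !lt_min e10 e20 e30 subr_gt0; case/andP: c1z2.
  by split; rewrite !ge_min lexx ?orbT.
(* The length of [J], the set of labels for which the gap persists. *)
exists (e *+ 2) => [|x y Ux Uy]; first by rewrite mulrn_wgt0.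
pose I := `]intercept R m x, intercept R m y[%classic.
pose J : set R := ball (s0 : R) e.
(* The quotient of the loss by [t], along [t = 1 / (n + 1)]. *)
pose f n s := (n.+1%:R%:E * loss R m A n.+1%:R^-1 s)%E.
have mf n : measurable_fun setT (f n).
  by apply: measurable_funeM; exact: measurable_loss.
have f0 n s : (0 <= f n s)%E by rewrite mule_ge0.
have mI : measurable I by exact: measurable_itv.
have mJ : measurable J by apply: open_measurable; exact: ball_open.
have f_ge k (h : R) s : 0 < h -> (forall t,
  0 < t < h -> ((k * t)%:E <= loss R m A t s)%E) ->
    (k%:E <= limn_einf (f^~ s))%E.
  move=> h0 kt; have [N _ hN] := near_infty_natSinv_lt (PosNum h0).
  apply: (@limn_einf_ge _ _ _ N) => n Nn.
  have n0 : 0 < n.+1%:R :> R by rewrite ltr0n.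
  have := kt n.+1%:R^-1 _; rewrite invr_gt0 n0 (hN n Nn) => /(_ isT).
  rewrite /f -(@lee_pmul2l _ n.+1%:R%:E)// -EFinM.
  by rewrite mulrCA divff ?mulr1// gt_eqF.
have pointwise s : ((\1_I s)%:E + (\1_J s)%:E <= limn_einf (f^~ s))%E.
  (* On [J] the value 2 bounds the sum of both indicators, whether or not [s] is in [I]. *)
  have [sJ|sJ] := pselect (J s).
    apply: (@le_trans _ _ 2%:E).
      rewrite -EFinD lee_fin !indicE; case: (s \in I); case: (s \in J) => /=; lra.
    apply: (f_ge 2 e) => //; apply: (loss_ge2 _ _ _ _ c1 z c2) => // r hr.
    - by apply/UA/B1; [exact: lt_le_trans ee1|exact: lt_le_trans ee1].
    - by apply/UA/B2; [exact: lt_le_trans ee2|exact: lt_le_trans ee2].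
    - by apply: B3; [exact: lt_le_trans ee3|exact: lt_le_trans ee3].
  rewrite [\1_J s]indicE memNset// adde0.
  have [sI|sI] := pselect (I s); last first.
    rewrite indicE memNset//; apply: (@limn_einf_ge _ _ _ 0) => n _; exact: f0.
  rewrite indicE mem_set//.
  have on_line w : U w -> U (w.1, intercept R m w + m * w.1).
    by rewrite /intercept subrK; case: w.
  (* The projection of [U] is an interval, so a line labelled between two intercepts of [U] meets
     [U]. *)
  have [r Ur] : exists r, U (r, s + m * r).
    apply: (iP (intercept R m x) (intercept R m y)).
    - by exists x.1; exact: on_line.
    - by exists y.1; exact: on_line.
    - by move: sI; rewrite /I/= in_itv/= => /andP[h1 h2]; rewrite !ltW.
  have [h h0 Bh] := line_nbhs _ _ _ _ _ oU Ur.
  apply: (f_ge 1 h) => // t th; rewrite mul1r;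
    apply: (loss_ge _ _ _ _ r h) => // r' hr.
  by apply/UA/Bh => //; rewrite subrr normr0.
have : (\int[mu]_s ((\1_I s)%:E + (\1_J s)%:E) <= C%:E)%E.
  apply: (@le_trans _ _ (\int[mu]_s limn_einf (f^~ s))%E).
    apply: ge0_le_integral => //.
    - by move=> s _; rewrite adde_ge0// lee_fin.
    - by apply: emeasurable_funD; apply/measurable_EFinP; exact: measurable_indic.
    - apply: measurableT_comp => //.
      by apply: measurable_fun_limn_esup => n; apply: measurableT_comp => //;
        exact: mf.
  apply: (le_trans (fatou mu measurableT mf (fun n s _ => f0 n s))).
  apply: limn_einf_le => n; rewrite /f ge0_integralZl//;
    last exact: measurable_loss.
  have n0 : 0 < n.+1%:R :> R by rewrite ltr0n.
  apply: (@le_trans _ _ (n.+1%:R%:E * (n.+1%:R^-1 * C)%:E)%E).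
    by apply: lee_wpmul2l; [rewrite lee_fin ltW|apply: lossC; rewrite invr_gt0].
  by rewrite -EFinM mulrA divff ?mul1r// gt_eqF.
rewrite ge0_integralD//; last 2 first.
- by apply/measurable_EFinP; exact: measurable_indic.
- by apply/measurable_EFinP; exact: measurable_indic.
rewrite !integral_indic// !setIT => IJC.
have muJ : mu J = (e *+ 2)%:E by apply: lebesgue_measure_ball; exact: ltW.
have muI : ((intercept R m y - intercept R m x)%:E <= mu I)%E.
  rewrite /I lebesgue_measure_itv/= lte_fin; case: ltP => xy;
    first by rewrite -EFinB.
  by rewrite lee_fin subr_le0.
have : ((intercept R m y - intercept R m x)%:E + (e *+ 2)%:E <= C%:E)%E.
  by apply: le_trans IJC; apply: leeD => //; rewrite -muJ.
by rewrite -EFinD lee_fin -lerBrDr.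
Qed.

(** * Lines of a fixed direction meet [A] without gaps *)

Lemma intercept_continuous (R : realType) (m : R) : continuous (intercept R m :
  plane R -> R).
Proof.
move=> z; apply: (@continuousB _ R^o); first exact: cvg_snd.
apply: (@continuousM _ _ (cst m)); first exact: cvg_cst.
exact: cvg_fst.
Qed.

(** Preimages of closed half-lines are closed, so the bound extends to the closure in one point at a
    time. *)
Lemma intercepts_within_closure (R : realType) (m : R) (U : set (plane R)) (L : R) :
  intercepts_within R m U L -> intercepts_within R m (closure U) L.
Proof.
move=> UL.
have step (F : set R) : closed F -> U `<=` intercept R m @^-1` F ->
    closure U `<=` intercept R m @^-1` F.
  move=> cF UF; apply: subset_trans (closure_subset UF) _.
  by apply: closed_comp => // z _; exact: intercept_continuous.
have half x y : U x -> closure U y -> intercept R m y <= L + intercept R m x.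
  move=> Ux; apply: (step [set v | v <= L + intercept R m x]);
    first exact: closed_le.
  by move=> w Uw /=; have := UL x w Ux Uw; lra.
move=> x y Ax Ay.
suff : intercept R m y - L <= intercept R m x by lra.
move: x Ax; apply: (step [set v | intercept R m y - L <= v]);
  first exact: closed_ge.
by move=> x Ux /=; have := half x y Ux Ay; lra.
Qed.

Lemma line_projectionE (R : realType) (m : R) (U : set (plane R)) :
  [set s | exists r, U (r, s + m * r)] = intercept R m @` U.
Proof.
apply/seteqP; split => [s [r Ur]|_ [z Uz <-]].
  by exists (r, s + m * r) => //; rewrite /intercept/= addrK.
by exists z.1; rewrite /intercept subrK; case: z Uz.
Qed.

(** The width of [A°] bounds that of [K], hence the loss of [K], which has the same integral as that
    of [A]. A gap would then make the width of [A°] smaller than itself. *)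
Lemma line_inside (R : realType) (A : set (plane R)) (m s0 c1 z c2 : R) :
  compact A -> regular A ->
  (exists K : set (plane R), convex_body K /\ covariogram A = covariogram K) ->
  is_interval (intercept R m @` A°) ->
  c1 < z < c2 -> A° (c1, s0 + m * c1) -> A° (c2, s0 + m * c2) -> A (z, s0 + m * z).
Proof.
move=> cA rA [K [bK gAK]] iP c1z2 U1 U2; apply: contrapT => nAz.
have [M hM] := compact_box _ _ cA.
(* [sup S] is the exact width of [A°], so no bound [sup S - d] with [d > 0] can hold. *)
pose S := [set d | exists x y, [/\ A° x,
  A° y & d = intercept R m y - intercept R m x]].
have absM w : A w -> `|intercept R m w| <= M + `|m| * M.
  move=> /hM[w1 w2]; apply: le_trans (ler_normB _ _) _.
  by rewrite normrM; apply: lerD => //; exact: ler_wpM2l.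
have hS : has_sup S.
  split; first by exists 0, (c1, s0 + m * c1), (c1, s0 + m * c1); rewrite subrr.
  exists ((M + `|m| * M) *+ 2) => _ [x [y [/interior_subset/absM Ax
    /interior_subset/absM Ay ->]]].
  by apply: le_trans (ler_norm _) _; apply: le_trans (ler_normB _ _) _;
    rewrite mulr2n lerD.
have UL : intercepts_within R m A° (sup S).
  by move=> x y Ux Uy; apply: (ub_le_sup hS.2); exists x, y.
have AL : intercepts_within R m A (sup S).
  by rewrite rA; exact: intercepts_within_closure.
have KL := covariogram_intercepts_within _ _ _ _ _ bK gAK AL.
have lossC t : 0 < t -> (\int[mu]_s loss R m A t s <= (t * sup S)%:E)%E.
  (* Both integrals are the same difference of covariogram values. *)
  move=> t0; rewrite integral_loss// gAK -integral_loss; last by case: bK.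
  exact: integral_loss_convex.
rewrite -line_projectionE in iP.
have [d d0 Ud] := intercepts_gap _ _ _ _ _ _ _ _ _ cA (@open_interior _ A)
  (@interior_subset _ A) iP c1z2 U1 U2 nAz lossC.
have : sup S <= sup S - d.
  by apply: (ge_sup hS.1) => _ [x [y [Ux Uy ->]]]; exact: Ud.
by lra.
Qed.

(** * Segments and components of the interior *)

Lemma segment_component (R : realType) (U : set (plane R)) (x y : plane R) :
  (forall p, 0 <= p -> p <= 1 -> U (plane_conv R p x y)) -> connected_component U
    x y.
Proof.
move=> Uxy.
have c1 : plane_conv R 1 x y = x.
  by rewrite /plane_conv subrr !mul0r !mul1r !addr0; case: x {Uxy}.
have c0 : plane_conv R 0 x y = y.
  by rewrite /plane_conv subr0 !mul0r !mul1r !add0r; case: y {Uxy c1}.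
apply: (@connected_component_max _ _ ((fun p => plane_conv R p x y) @` `[0, 1])).
- by exists 1 => //; rewrite /= in_itv/= ler01 lexx.
- by move=> _ [p /= + <-]; rewrite in_itv/= => /andP[p0 p1]; exact: Uxy.
- apply: connected_continuous_connected;
  first exact/connected_intervalP/interval_is_interval.
  apply: continuous_subspaceT => p.
  have lin (a b : R) : continuous (fun q : R => q * a + (1 - q) * b).
    move=> q; apply: cvgD; apply: cvgM; try exact: cvg_cst; first exact: cvg_id.
    by apply: cvgB; [exact: cvg_cst|exact: cvg_id].
  by apply: (@cvg_pair R R^o R^o (nbhs p) (nbhs _) (nbhs _)); exact: lin.
- by exists 0 => //; rewrite /= in_itv/= ler01 lexx.
Qed.

Lemma components_le2 (R : realType) (U : set (plane R)) (x y : plane R) :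
  (components U #<= `I_2)%card -> U x -> U y -> ~ connected_component U x y ->
  forall w, U w -> connected_component U x w \/ connected_component U y w.
Proof.
move=> /pcard_leP[f] Ux Uy nxy w Uw; set C := connected_component U.
have lt2 z : U z -> (f (C z) < 2)%N by move=> Uz; apply: (@funS _ _ _ _ f);
  exists z.
have injC u v : U u -> U v -> f (C u) = f (C v) -> C u v.
  move=> Uu Uv fuv; have -> : C u = C v by apply: (@inj _ _ _ f);
    rewrite ?inE //; [exists u|exists v].
  exact: connected_component_refl.
have neq : f (C x) <> f (C y) by move/(injC _ _ Ux Uy).
have [/(injC _ _ Ux Uw)|nx] := pselect (f (C x) = f (C w)); first by left.
have [/(injC _ _ Uy Uw)|ny] := pselect (f (C y) = f (C w)); first by right.
(* Three numbers below 2 cannot be pairwise distinct. *)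
by move: (f (C x)) (f (C y)) (f (C w)) (lt2 _ Ux) (lt2 _ Uy) (lt2 _ Uw) neq nx ny
  => [|[|?]] [|[|?]] [|[|?]].
Qed.

Lemma connected_intercepts (R : realType) (m : R) (V : set (plane R)) :
  connected V -> connected (intercept R m @` V).
Proof.
move=> cV; apply: connected_continuous_connected => //.
exact/continuous_subspaceT/intercept_continuous.
Qed.

(** Along the direction of [y - x] the two components project to intervals sharing the common
    intercept of [x] and [y], so [line_inside] applies. The covering hypothesis allows the
    components to coincide, so that the lemma serves again once [A°] is connected. *)
Lemma segment_interior (R : realType) (A : set (plane R)) (x y : plane R) :
  compact A -> regular A ->
  (exists K : set (plane R), convex_body K /\ covariogram A = covariogram K) ->
  A° x -> A° y -> x.1 < y.1 ->
  (forall w, A° w -> connected_component A° x w \/ connected_component A° y w) ->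
  forall p, 0 <= p -> p <= 1 -> A° (plane_conv R p x y).
Proof.
move=> cA rA gA Ux Uy xy cover p p0 p1.
pose m := (y.2 - x.2) / (y.1 - x.1).
have yx : y.1 - x.1 != 0 by rewrite subr_eq0 gt_eqF.
have mE : m * (y.1 - x.1) = y.2 - x.2 by rewrite divfK.
have iP : is_interval (intercept R m @` A°).
  apply/connected_intervalP.
  have -> : A° = connected_component A° x `|` connected_component A° y.
    apply/seteqP; split => [w /cover //|w].
    by case; exact: connected_component_sub.
  rewrite image_setU; apply: connectedU.
  - exists (intercept R m x); split; first by exists x => //;
    exact: connected_component_refl.
    exists y; first exact: connected_component_refl.
    by rewrite /intercept; lra.
  - exact/connected_intercepts/component_connected.
  - exact/connected_intercepts/component_connected.
(* [line_inside] wants a point strictly between the endpoints. *)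
have [->|p_neq0] := eqVneq p 0.
  by rewrite /plane_conv subr0 !mul0r !mul1r !add0r;
    case: y Uy {xy cover m yx mE iP}.
have [->|p_neq1] := eqVneq p 1.
  by rewrite /plane_conv subrr !mul0r !mul1r !addr0;
    case: x Ux {xy cover m yx mE iP}.
have pgt0 : 0 < p by rewrite lt_neqAle eq_sym p_neq0.
have plt1 : p < 1 by rewrite lt_neqAle p_neq1.
have /nbhs_ballP[e1 /= e10 B1] : nbhs x A° by apply: open_nbhs_nbhs; split => //;
  exact: open_interior.
have /nbhs_ballP[e2 /= e20 B2] : nbhs y A° by apply: open_nbhs_nbhs; split => //;
  exact: open_interior.
apply/nbhs_ballP; exists (Num.min e1 e2) => [/=|z [/=]];
  first by rewrite lt_min e10.
rewrite /ball/= !lt_min => /andP[z11 z12] /andP[z21 z22].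
set q := plane_conv R p x y in z11 z12 z21 z22.
(* The segment shifted by [z - q] passes through [z], and its ends stay in [A°]; this puts a whole
   ball about [q] in [A]. *)
pose w1 : R := z.1 - q.1; pose w2 : R := z.2 - q.2.
have Ux' : A° (x.1 + w1, x.2 + w2).
  by apply: B1; split; rewrite /ball/= opprD addNKr opprB.
have Uy' : A° (y.1 + w1, y.2 + w2).
  by apply: B2; split; rewrite /ball/= opprD addNKr opprB.
pose s0 := x.2 + w2 - m * (x.1 + w1).
have -> : z = (z.1, s0 + m * z.1) :> plane R.
  rewrite [LHS]surjective_pairing; congr pair.
  rewrite /s0 /w1 /w2 /q /plane_conv/=.
  by rewrite (_ : y.2 = x.2 + m * (y.1 - x.1)); [ring|rewrite mE addrC subrK].
apply: (line_inside _ _ _ _ (x.1 + w1) _ (y.1 + w1) cA rA gA iP).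
- have h1 : 0 < (1 - p) * (y.1 - x.1) by apply: mulr_gt0; rewrite subr_gt0.
  have h2 : 0 < p * (y.1 - x.1) by apply: mulr_gt0; rewrite ?subr_gt0.
  by rewrite /w1 /q /plane_conv/=; apply/andP; split; lra.
- by rewrite (_ : s0 + _ = x.2 + w2)// /s0 subrK.
- by rewrite (_ : s0 + _ = y.2 + w2)// /s0; move: mE; lra.
Qed.

Lemma connected_interior (R : realType) (A : set (plane R)) :
  compact A -> regular A -> (components A° #<= `I_2)%card ->
  (exists K : set (plane R), convex_body K /\ covariogram A = covariogram K) ->
  forall x y, A° x -> A° y -> connected_component A° x y.
Proof.
move=> cA rA c2 gA.
have lt x y : A° x -> A° y -> x.1 < y.1 -> connected_component A° x y.
  (* [nxy] provides the covering by two components; the resulting segment contradicts it. *)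
  move=> Ux Uy xy; apply: contrapT => nxy; apply: (nxy).
  by apply: segment_component; apply: segment_interior => //; exact: components_le2.
move=> x y Ux Uy; have [xy|yx|xy] := ltgtP x.1 y.1; first exact: lt.
  by apply: connected_component_sym; exact: lt.
have /nbhs_ballP[e /= e0 B] : nbhs x A° by apply: open_nbhs_nbhs; split => //;
  exact: open_interior.
(* Two points on a vertical line are joined through a point to the left of both. *)
pose x' : plane R := (x.1 - e / 2, x.2).
have Ux' : A° x'.
  apply: B; split; rewrite /ball/= ?subrr ?normr0//.
  by rewrite opprB addrC subrK gtr0_norm; lra.
have x'x : x'.1 < x.1 by rewrite /x'/=; lra.
apply: (@connected_component_trans _ _ x').
  by apply: connected_component_sym; exact: lt.
by apply: lt => //; rewrite -xy.
Qed.

(** * From the interior to its closure *)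

(** This keeps approximating segments from being vertical: a point with abscissa [c] is moved
    slightly to the right within [U]. *)
Lemma closure_avoid (R : realType) (U : set (plane R)) (x : plane R) (c e : R) :
  open U -> closure U x -> 0 < e ->
  exists z, [/\ U z, z.1 != c, `|x.1 - z.1| < e & `|x.2 - z.2| < e].
Proof.
move=> oU clx e0.
have [z [Uz [/= z1 z2]]] := clx _ (nbhsx_ballx x e e0).
have [zc|] := eqVneq z.1 c; last by exists z.
have /nbhs_ballP[d /= d0 B] : nbhs z U by exact: open_nbhs_nbhs.
rewrite /ball/= in z1 z2.
pose h := Num.min d (e - `|x.1 - z.1|) / 2.
have [h0 hd he] : [/\ 0 < h, h < d & h < e - `|x.1 - z.1|].
  have m0 : 0 < Num.min d (e - `|x.1 - z.1|) by rewrite lt_min d0 subr_gt0.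
  have md : Num.min d (e - `|x.1 - z.1|) <= d by rewrite ge_min lexx.
  have me : Num.min d (e - `|x.1 - z.1|) <= e - `|x.1 - z.1| by rewrite ge_min
    lexx orbT.
  by rewrite /h; split; lra.
exists (z.1 + h, z.2); split => //=.
- apply: B; split; rewrite /ball/= ?subrr ?normr0//.
  by rewrite opprD addNKr normrN gtr0_norm.
- by rewrite zc -subr_eq0 addrAC subrr add0r gt_eqF.
- rewrite opprD addrA; apply: le_lt_trans (ler_normB _ _) _.
  by rewrite (gtr0_norm h0); lra.
Qed.

Theorem theorem1p2 (R : realType) (A : set (plane R))
    (cptA : compact A) (regA : regular A) (compA : (components A° #<= `I_2)%card)
    (covA : exists K : set (plane R),
      convex_body K /\ covariogram A = covariogram K) :
  @convex_set R (plane R) A.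
Proof.
have conn := connected_interior _ _ cptA regA compA covA.
have seg x y p : A° x -> A° y -> x.1 != y.1 -> 0 <= p -> p <= 1 -> A (plane_conv
  R p x y).
  move=> Ux Uy xy p0 p1; apply: interior_subset.
  move: xy; rewrite neq_lt => /orP[xy|yx].
    by apply: segment_interior => // w Uw; left; exact: conn.
  (* [segment_interior] takes the left endpoint first. *)
  have -> : plane_conv R p x y = plane_conv R (1 - p) y x.
    by rewrite /plane_conv; congr pair; ring.
  by apply: segment_interior => //; [move=> w Uw; left; exact: conn|lra|lra].
apply/convex_setP => x y p Ax Ay p0 p1.
apply: (compact_closed_plane _ _ cptA) => V /nbhs_ballP[e /= e0 eV].
have clx : closure A° x by rewrite -regA.
have cly : closure A° y by rewrite -regA.
(* The abscissa 0 avoided by [x'] is arbitrary; [y'] then avoids the abscissa of [x']. *)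
have [x' [Ux' _ x1 x2]] := closure_avoid _ _ _ 0 _ (@open_interior _ A) clx e0.
have [y' [Uy' yx' y1 y2]] := closure_avoid _ _ _ x'.1 _ (@open_interior _ A) cly e0.
exists (plane_conv R p x' y'); split; first by apply: seg => //; rewrite eq_sym.
have close (a a' b b' : R) : `|a - a'| < e -> `|b - b'| < e ->
    `|p * a + (1 - p) * b - (p * a' + (1 - p) * b')| < e.
  move=> ha hb; have p0' : 0 <= 1 - p by rewrite subr_ge0.
  have -> : p * a + (1 - p) * b - (p * a' + (1 - p) * b') = p * (a - a') +
    (1 - p) * (b - b') by ring.
  apply: le_lt_trans (ler_normD _ _) _;
    rewrite !normrM (ger0_norm p0) (ger0_norm p0').
  (* A common bound below [e] gives a strict inequality even when [p] is 0 or 1. *)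
  have [w [wa wb we]] : exists w, [/\ `|a - a'| <= w, `|b - b'| <= w & w < e].
    by exists (Num.max `|a - a'| `|b - b'|);
      rewrite !le_max gt_max ha hb !lexx orbT.
  have pa := ler_wpM2l p0 wa.
  by have pb := ler_wpM2l p0' wb; lra.
by apply: eV; split; apply: close.
Qed.
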